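(* Let $X_{\mu,\varepsilon}$ be a two-parameter family of $C^r$ ($r\ge2$) vector fields on $\mathbb{R}^{n+1}$, $n\ge2$, all invariant under an involution $R$, with an $R$-symmetric saddle equilibrium $O$ ($RO=O$, $R$ linear near $O$), $\dim W^u(O)=1$, with characteristic exponents $\gamma>0>\lambda_1>\max_{i\ge2}\mathrm{Re}\,\lambda_i$, whose eigenvectors satisfy $Re_0=-e_0$ (for $\gamma$) and $Re_1=e_1$ (for $\lambda_1$), so that the two unstable separatrices satisfy $\Gamma_+=R\Gamma_-$. Assume that at $(\mu,\varepsilon)=(0,0)$: (i) both $\Gamma_\pm$ are homoclinic to $O$ and tend to $O$ tangentially to $e_1$ (homoclinic butterfly); (ii) $\gamma+\lambda_1=0$; (iii) the separatrix value $A$ satisfies $0<|A|<2$. Assume the family is a generic unfolding in the sense that, on a common symmetric cross-section $\Pi$ with coordinates $(u,v)$ ($u$ along $e_1$, $\{u=0\}=\Pi\cap W^s_{loc}(O)$), the Poincaré map has the form $$\bar u=\big(\mu+A|u|^{1-\varepsilon}+p(|u|,Q_{s(u)}v,\mu,\varepsilon)\big)s(u),\qquad \bar v=Q_{s(u)}\big(v_++B|u|^{1-\varepsilon}+q(|u|,Q_{s(u)}v,\mu,\varepsilon)\big),$$ where $s(u)=\mathrm{sign}(u)$, $Q_1=\mathrm{Id}$, $Q_{-1}$ is $R$ restricted to the $v$-space, $A,B,v_+$ depend continuously on $(\mu,\varepsilon)$, and $\|p,q,\partial_v(p,q)\|=o(|u|^{1-\varepsilon})$, $\|\partial_u(p,q)\|=o(|u|^{-\varepsilon})$.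 Then there is an open region $V_{LA}$ in the $(\mu,\varepsilon)$-plane whose closure contains $(0,0)$ such that $X_{\mu,\varepsilon}$ possesses a Lorenz attractor for all $(\mu,\varepsilon)\in V_{LA}$.
   Context: Lorenz attractor (Afraimovich–Bykov–Shilnikov sense): with $\Pi$ a cross-section transverse to $W^s(O)$, $\Pi_0$ its first intersection with $W^s(O)$ splitting $\Pi$ into $\Pi_\pm=\{\pm u>0\}$, the system possesses a Lorenz attractor if both unstable separatrices hit $\Pi$ and there is a closed region $D\subset\Pi$ with $T(D\setminus\Pi_0)\subset\mathrm{int}(D)$ for the Poincaré map $T:\ \bar u=f_\pm(u,v),\ \bar v=g_\pm(u,v)$ on $\Pi_\pm$, satisfying $$\|(f'_u)^{-1}\|_\circ<1,\quad \|g'_v\|_\circ<1,\quad \|g'_u(f'_u)^{-1}\|_\circ\,\|f'_v\|_\circ<(1-\|(f'_u)^{-1}\|_\circ)(1-\|g'_v\|_\circ),$$ with $\|\cdot\|_\circ=\sup_{D\cap\Pi_\pm}\|\cdot\|$. The separatrix value $A$ is the coefficient of $|u|^{\nu}$, $\nu=|\lambda_1|/\gamma$, in the asymptotics $\bar u=u_++A|u|^\nu+o(|u|^\nu)$ of the Poincaré map near $\Pi_0$ on the side $u>0$; in the parametrised family $\mu=u_+$ is the splitting of the loops and $\nu=1-\varepsilon$. *)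

(* Defs.v *)
From HB Require Import structures.
From mathcomp Require Import all_boot all_order all_algebra.
From mathcomp Require Import all_classical all_reals all_analysis.
Set Implicit Arguments. Unset Strict Implicit. Unset Printing Implicit Defensive.
Import Order.TTheory GRing.Theory Num.Theory.
Import numFieldNormedType.Exports.
Local Open Scope classical_set_scope.
Local Open Scope ring_scope.

(* Points of the cross-section Pi are pairs (u, v) : R * 'rV[R]_k,
   u along e_1, v in the k = n-1 dimensional v-space; Pi_0 = {u = 0}. *)

(* Q_{s(u)} : identity for u > 0, the involution Q = R|_v (acting on row
   vectors by v *m Q) for u < 0. *)
Definition Qs (R : realType) (k : nat) (Q : 'M[R]_k) (u : R) (v : 'rV[R]_k)
  : 'rV[R]_k := if 0 < u then v else v *m Q.

Definition poincare_u (R : realType) (k : nat) (Q : 'M[R]_k) (A : R -> R -> R)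
  (p : R -> 'rV[R]_k -> R -> R -> R) (mu eps : R) (x : R * 'rV[R]_k) : R :=
  (mu + A mu eps * (`|x.1| `^ (1 - eps)) + p `|x.1| (Qs Q x.1 x.2) mu eps)
    * Num.sg x.1.

Definition poincare_v (R : realType) (k : nat) (Q : 'M[R]_k)
  (B vp : R -> R -> 'rV[R]_k)
  (q : R -> 'rV[R]_k -> R -> R -> 'rV[R]_k) (mu eps : R) (x : R * 'rV[R]_k)
  : 'rV[R]_k :=
  Qs Q x.1 (vp mu eps + (`|x.1| `^ (1 - eps)) *: B mu eps
            + q `|x.1| (Qs Q x.1 x.2) mu eps).

Definition section_box (R : realType) (k : nat) (Q : 'M[R]_k) (delta K : R)
  : set (R * 'rV[R]_k) :=
  [set x | `|x.1| < delta /\ `|x.2| < K /\ `|x.2 *m Q| < K].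

Definition pd_u (R : realType) (k : nat) (V : normedModType R)
  (h : R * 'rV[R]_k -> V) (x : R * 'rV[R]_k) : V :=
  derive1 (fun u => h (u, x.2)) x.1.
Definition pd_v (R : realType) (k : nat) (V : normedModType R)
  (h : R * 'rV[R]_k -> V) (x : R * 'rV[R]_k) : 'rV[R]_k -> V :=
  'd (fun w : 'rV[R]_k => h (x.1, w)) (x.2).

(* Lorenz attractor in the Afraimovich–Bykov–Shilnikov sense, for the
   Poincaré map T = (f, g) on the cross-section Pi, where Pp / Pm are the
   points where the unstable separatrices Gamma_+ / Gamma_- hit Pi.
   The sup-norms ||.||_o over D ∩ Pi_± are expressed through uniform bounds
   a, b, c, d (equivalent to the sup formulation). *)
Definition lorenz_attractor (R : realType) (k : nat)
  (f : R * 'rV[R]_k -> R) (g : R * 'rV[R]_k -> 'rV[R]_k)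
  (Pi : set (R * 'rV[R]_k)) (Pp Pm : R * 'rV[R]_k) : Prop :=
  Pi Pp /\ Pi Pm /\
  exists D : set (R * 'rV[R]_k),
    (closed D /\ D `<=` Pi /\ interior D !=set0 /\
     D = closure (interior D) /\
     (exists x, D x /\ 0 < x.1) /\ (exists x, D x /\ x.1 < 0) /\
     (forall x, D x -> x.1 != 0 -> interior D (f x, g x))) /\
    (forall x, D x -> x.1 != 0 ->
       [/\ derivable (fun u => f (u, x.2)) x.1 1,
           derivable (fun u => g (u, x.2)) x.1 1,
           differentiable (fun w : 'rV[R]_k => f (x.1, w)) x.2,
           differentiable (fun w : 'rV[R]_k => g (x.1, w)) x.2 &
           pd_u f x != 0]) /\
    exists a b c d : R,
      [/\ a < 1, b < 1, c * d < (1 - a) * (1 - b) &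
        forall x, D x -> x.1 != 0 ->
        [/\ `|(pd_u f x)^-1| <= a,
            (forall h, `|pd_v g x h| <= b * `|h|),
            `|pd_u g x| * `|(pd_u f x)^-1| <= c &
            (forall h, `|pd_v f x h| <= d * `|h|)]].

(* Main.v *)
Require Import Defs.
From HB Require Import structures.
From mathcomp Require Import all_boot all_order all_algebra.
From mathcomp Require Import all_classical all_reals all_analysis.
From mathcomp Require Import ring lra.
Import Order.TTheory GRing.Theory Num.Theory.
Import numFieldNormedType.Exports.
Local Open Scope classical_set_scope.
Local Open Scope ring_scope.

(* Put [A0 = |A 0 0|] and fix [a] with [1 < a < 2] and [A0 < a].  If [c] is small
   and [eps > 0] is such that [A0 * c `^ (- eps)] is close to [a], the rescaling
   [u = c y] turns the truncated Poincare map into a map close to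
   [y |-> (mu / c +- a |y|) sign y], [+-] being the sign of [A 0 0].  For
   [mu / c] close to [-+ a / 2] it sends [-1, 1] strictly into itself, and since
   [|u| `^ (- eps)] increases as [u] tends to 0, its slope is bounded below by a
   number larger than 1 on the whole of [|u| <= c].  All v-derivatives are
   O(|u| `^ (1 - eps)) = O(c), while the ratio of the u-derivatives of [g] and
   [f] stays bounded, so the cone condition holds for small [c]. *)

(** * Right multiplication by a matrix, and linear changes of variable on both sides of a map *)

(** Requiring [1 <= L] lets one constant serve both branches of [Qs]: bounds carrying factors [L]
    for u < 0 remain valid for u > 0, where the linear map is the identity. *)
Lemma mulmx_norm_bound {R : realType} {k l : nat} (M : 'M[R]_(k, l)) :
  exists2 L : R, 1 <= L & forall v : 'rV[R]_k, `|v *m M| <= L * `|v|.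
Proof.
have coefE m n (N : 'M[R]_(m, n)) i j : `|N i j| <= `|N|.
  rewrite [leRHS]/Num.norm /= mx_normrE.
  by apply/bigmax_geP; right => /=; exists (i, j).
exists (1 + k%:R * `|M|); first by rewrite lerDl mulr_ge0.
move=> v; rewrite [leLHS]/Num.norm /= mx_normrE.
apply: bigmax_le; first by rewrite mulr_ge0// addr_ge0// mulr_ge0.
move=> [i j] _; rewrite mxE (le_trans (ler_norm_sum _ _ _))//=.
rewrite (@le_trans _ _ (\sum_(s < k) `|M| * `|v|))//.
  apply: ler_sum => s _; rewrite normrM mulrC.
  by apply: ler_pM => //; exact: coefE.
rewrite sumr_const card_ord -[_ *+ _]mulr_natl mulrA mulrDl mul1r lerDr.
exact: normr_ge0.
Qed.

Lemma mulmxr_continuous {R : realType} {k l : nat} (M : 'M[R]_(k, l)) :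
  continuous (mulmxr M : 'rV[R]_k -> 'rV[R]_l).
Proof.
apply/linear_bounded_continuous.
have [L L1 ML] := mulmx_norm_bound M.
apply/(bounded_funP ((mulmxr M : {linear 'rV[R]_k -> 'rV[R]_l}))) => r.
exists (L * r) => x xr; apply: (le_trans (ML x)).
by rewrite ler_pM2l// (lt_le_trans _ L1).
Qed.

(** Chain rule for the branch u < 0, which is the branch u > 0 composed with linear maps: [M] is
    [-%R] for the u-derivative and [mulmxr Q] for the v-derivative. *)
Lemma diff_linear_conj {R : realType} {U V V' W : normedModType R}
    (M : {linear U -> V}) (F : V -> V') (E : {linear V' -> W}) (x : U) :
  continuous E -> continuous M -> differentiable F (M x) ->
  differentiable (E \o (F \o M)) x /\
  forall y, 'd (E \o (F \o M)) x y = E ('d F (M x) (M y)).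
Proof.
move=> Ec Mc dF.
have dM : differentiable M x by exact: linear_differentiable.
have dG : differentiable (F \o M) x by exact: differentiable_comp.
have dE : differentiable E ((F \o M) x) by exact: linear_differentiable.
split; first exact: differentiable_comp.
move=> y; rewrite (diff_comp dG dE) (diff_comp dM dF) /=.
by rewrite (diff_lin _ Ec) (diff_lin _ Mc).
Qed.

(** * Partial derivatives of a map whose two branches are exchanged by the involution *)

Section equivariant_map.
Context {R : realType} {k : nat} {V : normedModType R} (Q : 'M[R]_k).
Variables (h : R * 'rV[R]_k -> V) (F : R -> 'rV[R]_k -> V) (E : {linear V -> V}).
Hypothesis Ec : continuous E.
Hypothesis h_pos : forall u v, 0 < u -> h (u, v) = F u v.
Hypothesis h_neg : forall u v, u < 0 -> h (u, v) = E (F (- u) (v *m Q)).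

(** The minus sign in [- E dF] is the inner derivative of u -> -u. Each formula for [h] holds on an
    open half-line only, so the derivative is transferred by equality near [x.1]. *)
Lemma equivariant_pd_u x (dF : V) : x.1 != 0 ->
  is_derive (`|x.1| : R) 1 (F^~ (Qs Q x.1 x.2)) dF ->
  derivable (fun u => h (u, x.2)) x.1 1 /\
  pd_u h x = if 0 < x.1 then dF else - E dF.
Proof.
case: x => u v /= u0; rewrite /pd_u /Qs /= => dFP.
suff : is_derive u 1 (fun u => h (u, v)) (if 0 < u then dF else - E dF).
  by case=> ? <-; rewrite derive1E.
move: u0; rewrite neq_lt => /orP[u0|u0].
  move: dFP; rewrite ltNge (ltW u0)/= ltr0_norm// => dFP.
  apply: (@near_eq_is_derive _ _ _ (E \o (F^~ (v *m Q) \o -%R))).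
    by near=> z; rewrite h_neg//; near: z; exact: lt_nbhsl.
  have dFd : differentiable (F^~ (v *m Q)) (- u).
    by apply/derivable1_diffP; case: dFP.
  have [dEF EF] := @diff_linear_conj R _ _ _ _ -%R _ E u Ec
    (@oppr_continuous _ R) dFd.
  apply: DeriveDef; first exact/derivable1_diffP.
  rewrite deriveE// EF; case: dFP => ? <-.
  by rewrite linearN linearN deriveE.
move: dFP; rewrite u0 gtr0_norm// => dFP.
apply: near_eq_is_derive dFP.
by near=> z; rewrite h_pos//; near: z; exact: lt_nbhsr.
Unshelve. all: by end_near. Qed.

Lemma equivariant_pd_v x : x.1 != 0 ->
  differentiable (F `|x.1|) (Qs Q x.1 x.2) ->
  differentiable (fun w => h (x.1, w)) x.2 /\
  forall y, pd_v h x y =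
    if 0 < x.1 then 'd (F `|x.1|) (Qs Q x.1 x.2) y
    else E ('d (F `|x.1|) (Qs Q x.1 x.2) (y *m Q)).
Proof.
case: x => u v /=; rewrite neq_lt /Qs /pd_v /= => /orP[u0|u0].
  rewrite ltNge (ltW u0)/= ltr0_norm// => dF.
  have -> : (fun w => h (u, w)) = E \o (F (- u) \o mulmxr Q).
    by apply/funext => w; rewrite h_neg.
  exact: (@diff_linear_conj R _ _ _ _ (mulmxr Q) (F (- u)) E v Ec
            (mulmxr_continuous Q) dF).
rewrite u0 (gtr0_norm u0) => dF.
have -> : (fun w => h (u, w)) = F u by apply/funext => w; rewrite h_pos.
by split.
Qed.

End equivariant_map.

(** * Symmetric boxes in the cross-section *)

(** The norm need not be invariant under [Q]; bounding [x.2 *m Q] as well makes the box symmetric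
    for an involution [Q], and places [Qs Q x.1 x.2] in the ball of radius [K]. *)
Definition closed_box {R : realType} {k : nat} (Q : 'M[R]_k) (c K : R)
  : set (R * 'rV[R]_k) :=
  [set x | `|x.1| <= c /\ `|x.2| <= K /\ `|x.2 *m Q| <= K].

Section boxes.
Context {R : realType} {k : nat} (Q : 'M[R]_k) (c K : R).

Let norm_fst (x : R * 'rV[R]_k) : R := `|x.1|.
Let norm_snd (x : R * 'rV[R]_k) : R := `|x.2|.
Let norm_sndQ (x : R * 'rV[R]_k) : R := `|x.2 *m Q|.

Let norm_fst_continuous : continuous norm_fst.
Proof. by move=> x; apply: continuous_comp; [exact: cvg_fst|exact: norm_continuous]. Qed.

Let norm_snd_continuous : continuous norm_snd.
Proof. by move=> x; apply: continuous_comp; [exact: cvg_snd|exact: norm_continuous]. Qed.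

Let norm_sndQ_continuous : continuous norm_sndQ.
Proof.
move=> x; apply: continuous_comp; last exact: norm_continuous.
apply: (@continuous_comp _ _ _ snd (mulmxr Q : _ -> 'rV[R]_k)); first exact: cvg_snd.
exact: mulmxr_continuous.
Qed.

Lemma open_section_box : open (section_box Q c K).
Proof.
have -> : section_box Q c K = norm_fst @^-1` [set y | y < c] `&`
    (norm_snd @^-1` [set y | y < K] `&` norm_sndQ @^-1` [set y | y < K]) by [].
by apply: openI; [|apply: openI]; apply: open_comp => //; exact: open_lt.
Qed.

Lemma closed_closed_box : closed (closed_box Q c K).
Proof.
have -> : closed_box Q c K = norm_fst @^-1` [set y | y <= c] `&`
    (norm_snd @^-1` [set y | y <= K] `&` norm_sndQ @^-1` [set y | y <= K]) by [].
by apply: closedI; [|apply: closedI]; apply: closed_comp => //; exact: closed_le.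
Qed.

Lemma section_box_interior : section_box Q c K `<=` interior (closed_box Q c K).
Proof.
rewrite -open_subsetE; last exact: open_section_box.
by move=> x [xc [xK xQ]]; split; [exact: ltW|split; exact: ltW].
Qed.

Hypotheses (c0 : 0 < c) (K0 : 0 < K).

(** The box is star-shaped about the origin: scaling a point by t < 1 moves it into the open box,
    and the scaled points converge to it as t tends to 1. *)
Lemma closed_box_regular : closed_box Q c K = closure (interior (closed_box Q c K)).
Proof.
rewrite eqEsubset; split; last first.
  rewrite [X in _ `<=` X](closure_id _).1; last exact: closed_closed_box.
  by apply: closureS; exact: interior_subset.
move=> x [xc [xK xQ]] U Ux.
have shrink : (t *: x.1, t *: x.2) @[t --> (1 : R)^'-] --> x.
  have cvg1 (V : normedModType R) (z : V) : t *: z @[t --> (1 : R)^'-] --> z.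
    rewrite -[X in _ --> X]scale1r; apply: cvgZr_tmp.
    exact/cvg_at_left_filter/cvg_id.
  case: x {xc xK xQ Ux} => x1 x2; exact: (cvg_pair (cvg1 _ x1) (cvg1 _ x2)).
have [t [t1 t0] Ut] : exists2 t : R, t < 1 /\ 0 < t & U (t *: x.1, t *: x.2).
  near (1 : R)^'- => t; exists t; first split.
  - by near: t; exact: nbhs_left_lt.
  - by near: t; exact: nbhs_left_gt.
  - by near: t; exact: shrink Ux.
exists (t *: x.1, t *: x.2); split=> //; apply: section_box_interior.
have tlt (V : normedModType R) (z : V) e : 0 < e -> `|z| <= e -> `|t *: z| < e.
  move=> e0 ze; rewrite normrZ gtr0_norm//.
  by apply: (le_lt_trans (ler_wpM2l (ltW t0) ze)); rewrite gtr_pMl.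
split; first exact: tlt.
by split; [exact: tlt|rewrite /= -scalemxAl; exact: tlt].
Unshelve. all: by end_near. Qed.

End boxes.

(** * Reduction of the attractor conditions to the branch u > 0 *)

(** The region is a symmetric closed box, and the branch u < 0 differs from [(F, G)] only by signs
    and factors [Q], so bounds on [(F, G)] survive up to factors [L]. The u-derivatives may blow up
    as r tends to 0; only the lower bound [lam] and the ratio bound [rho] are asked of them. *)
Lemma equivariant_lorenz_attractor {R : realType} {k : nat} (Q : 'M[R]_k)
    (f : R * 'rV[R]_k -> R) (g : R * 'rV[R]_k -> 'rV[R]_k)
    (F : R -> 'rV[R]_k -> R) (G : R -> 'rV[R]_k -> 'rV[R]_k)
    (Pp Pm : R * 'rV[R]_k) (delta K c K' L lam rho b d : R) :
  Q *m Q = 1%:M -> (forall v : 'rV[R]_k, `|v *m Q| <= L * `|v|) ->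
  1 <= L -> 0 < c < delta -> 0 < K' < K ->
  (forall u v, 0 < u -> f (u, v) = F u v) ->
  (forall u v, u < 0 -> f (u, v) = - F (- u) (v *m Q)) ->
  (forall u v, 0 < u -> g (u, v) = G u v) ->
  (forall u v, u < 0 -> g (u, v) = G (- u) (v *m Q) *m Q) ->
  (forall r w, 0 < r <= c -> `|w| <= K' ->
    [/\ derivable (F^~ w) r 1, derivable (G^~ w) r 1,
        differentiable (F r) w & differentiable (G r) w]) ->
  (forall r w, 0 < r <= c -> `|w| <= K' ->
    [/\ lam <= `|derive1 (F^~ w) r|,
        `|derive1 (G^~ w) r| <= rho * `|derive1 (F^~ w) r|,
        forall y, `|'d (F r) w y| <= d * `|y| &
        forall y, `|'d (G r) w y| <= b * `|y|]) ->
  (forall r w, 0 < r <= c -> `|w| <= K' ->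
    [/\ `|F r w| < c, `|G r w| < K' & `|G r w *m Q| < K']) ->
  1 < lam -> 0 <= b -> 0 <= d -> 0 <= rho -> L * b * L < 1 ->
  L * rho * (d * L) < (1 - lam^-1) * (1 - L * b * L) ->
  section_box Q delta K Pp -> section_box Q delta K Pm ->
  lorenz_attractor f g (section_box Q delta K) Pp Pm.
Proof.
move=> QQ QL L1 /andP[c0 cdelta] /andP[K'0 K'K] fp fn gp gn reg der bnd.
move=> lam1 b0 d0 rho0 Lb Lcone HPp HPm; split=> //; split=> //.
have L0 : 0 < L by exact: lt_le_trans ltr01 L1.
exists (closed_box Q c K').
have inD x : closed_box Q c K' x -> x.1 != 0 ->
    0 < `|x.1| <= c /\ `|Qs Q x.1 x.2| <= K'.
  move=> [xc [xK xQ]] x0; rewrite normr_gt0 x0 xc; split=> //.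
  by rewrite /Qs; case: ifP.
have fn' u v : u < 0 -> f (u, v) = (-%R : R -> R) (F (- u) (v *m Q)) by exact: fn.
have gn' u v : u < 0 -> g (u, v) = mulmxr Q (G (- u) (v *m Q)) by exact: gn.
have Nc : continuous (-%R : R -> R) by exact: oppr_continuous.
have Mc := mulmxr_continuous Q.
have fu x : closed_box Q c K' x -> x.1 != 0 ->
    derivable (fun u => f (u, x.2)) x.1 1 /\
    `|pd_u f x| = `|derive1 (F^~ (Qs Q x.1 x.2)) `|x.1| |.
  move=> Dx x0; have [xc xK] := inD x Dx x0.
  have [dF _ _ _] := reg _ _ xc xK.
  have dFP := derivableP dF.
  have [? ->] := equivariant_pd_u Q f F (-%R) Nc fp fn' x _ x0 dFP.
  by split=> //; rewrite derive1E; case: ifP => // _; rewrite !normrN.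
have gu x : closed_box Q c K' x -> x.1 != 0 ->
    derivable (fun u => g (u, x.2)) x.1 1 /\
    `|pd_u g x| <= L * `|derive1 (G^~ (Qs Q x.1 x.2)) `|x.1| |.
  move=> Dx x0; have [xc xK] := inD x Dx x0.
  have [_ dG _ _] := reg _ _ xc xK.
  have dGP := derivableP dG.
  have [? ->] := equivariant_pd_u Q g G (mulmxr Q) Mc gp gn' x _ x0 dGP.
  split=> //; rewrite derive1E; case: ifP => _; last by rewrite normrN QL.
  by rewrite ler_peMl.
split; [split|split].
- exact: closed_closed_box.
- split; first by move=> x [xc [xK xQ]]; split; [|split]; apply: le_lt_trans; eassumption.
  have v0 : `|(0 : 'rV[R]_k)| <= K' by rewrite normr0 ltW.
  have int0 : interior (closed_box Q c K') (0, 0).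
    by apply: section_box_interior; rewrite /section_box /= mul0mx !normr0.
  split; first by exists (0, 0).
  split; first exact: closed_box_regular.
  split; first by exists (c, 0); rewrite /closed_box /= mul0mx gtr0_norm ?lexx.
  split.
    by exists (- c, 0); rewrite /closed_box /= mul0mx normrN gtr0_norm ?lexx ?oppr_lt0.
  move=> x Dx x0; have [xc xK] := inD x Dx x0.
  have [bF bG bGQ] := bnd _ _ xc xK.
  apply: section_box_interior; case: x x0 {Dx} xc xK bF bG bGQ => u v /= u0 _ _.
  rewrite /Qs; move: u0; rewrite neq_lt => /orP[u0|u0].
    (* For u < 0 the image is [G *m Q]; since [Q] is an involution, the two bounds on v defining the
       box merely exchange roles. *)
    rewrite (le_gtF (ltW u0)) (ltr0_norm u0) /section_box/= fn// gn// normrN.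
    by rewrite -mulmxA QQ mulmx1.
  by rewrite u0 (gtr0_norm u0) /section_box/= fp// gp.
- move=> x Dx x0; have [xc xK] := inD x Dx x0.
  have [_ _ dF dG] := reg _ _ xc xK.
  have [dfu fuE] := fu x Dx x0; have [dgu _] := gu x Dx x0.
  have [dfv _] := equivariant_pd_v Q f F (-%R) Nc fp fn' x x0 dF.
  have [dgv _] := equivariant_pd_v Q g G (mulmxr Q) Mc gp gn' x x0 dG.
  split=> //; have [lamF _ _ _] := der _ _ xc xK.
  by rewrite -normr_gt0 fuE (lt_le_trans _ lamF)// (lt_trans _ lam1).
(* A left factor [L] comes from the [Q] applied to the value of [G], a right one from the [Q]
   applied to a v-increment; the u-component carries only a sign outside. *)
- exists lam^-1, (L * b * L), (L * rho), (d * L); split=> //.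
    by rewrite invf_lt1// (lt_trans _ lam1).
  move=> x Dx x0; have [xc xK] := inD x Dx x0.
  have [_ _ dF dG] := reg _ _ xc xK.
  have [_ fuE] := fu x Dx x0; have [_ guE] := gu x Dx x0.
  have [_ fvE] := equivariant_pd_v Q f F (-%R) Nc fp fn' x x0 dF.
  have [_ gvE] := equivariant_pd_v Q g G (mulmxr Q) Mc gp gn' x x0 dG.
  have [lamF rhoG dFb dGb] := der _ _ xc xK.
  have lam0 : 0 < lam by rewrite (lt_trans _ lam1).
  have F0 := lt_le_trans lam0 lamF.
  split.
  + by rewrite normfV fuE lef_pV2.
  + move=> y; rewrite gvE; case: ifP => _.
      apply: (le_trans (dGb _)); apply: ler_wpM2r => //.
      by rewrite mulrAC ler_peMl// mulr_ege1.
    apply: (le_trans (QL _)); rewrite -!mulrA (ler_wpM2l (ltW L0))//.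
    by apply: (le_trans (dGb _)); rewrite ler_wpM2l.
  + rewrite normfV fuE ler_pdivrMr// (le_trans guE)// -mulrA.
    by rewrite ler_wpM2l// ltW.
  + move=> y; rewrite fvE; case: ifP => _.
      by apply: (le_trans (dFb _)); rewrite ler_wpM2r// ler_peMr.
    rewrite normrN; apply: (le_trans (dFb _)); rewrite -mulrA.
    by rewrite ler_wpM2l.
Qed.

(** * Derivatives of a power term plus a remainder *)

Section power_map.
Context {R : realType} {U V : normedModType R}.
Variables (y0 beta : V) (P : R -> U -> V) (e : R).
(** Both components on u > 0 have this shape: [(y0, beta, P)] is built from [mu, A, p] for the first
    and from [vp, B, q] for the second. *)
Let H r w := y0 + (r `^ (1 - e)) *: beta + P r w.

Lemma power_map_derive1 r w : 0 < r -> derivable (P^~ w) r 1 ->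
  derivable (H^~ w) r 1 /\
  derive1 (H^~ w) r = ((1 - e) * r `^ (- e)) *: beta + derive1 (P^~ w) r.
Proof.
move=> r0 /derivable1_diffP dP.
have [/derivable1_diffP dk kE] := is_derive1_powR (1 - e) r0.
have dkb : differentiable (fun z : R => (z `^ (1 - e)) *: beta) r.
  exact: differentiableZl.
have dC : differentiable (cst y0 : R -> V) r by exact: differentiable_cst.
have d1 : differentiable (cst y0 + (fun z : R => (z `^ (1 - e)) *: beta)) r.
  exact: differentiableD.
have -> : H^~ w = (cst y0 + (fun z : R => (z `^ (1 - e)) *: beta)) + P^~ w.
  by apply/funext.
have d2 := differentiableD d1 dP.
split; first exact/derivable1_diffP.
rewrite (derive1E' d2) (derive1E' dP) (diffD d1 dP) /=.
congr (_ + _); rewrite (diffD dC dkb) /= diff_cst add0r.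
rewrite (diffZl _ dk); congr (_ *: _).
by rewrite -(deriveE _ dk) kE; congr (_ * _ `^ _); ring.
Qed.

Lemma power_map_diff r w : differentiable (P r) w ->
  differentiable (H r) w /\ forall y, 'd (H r) w y = 'd (P r) w y.
Proof.
move=> dP; have -> : H r = cst (y0 + (r `^ (1 - e)) *: beta) + P r.
  by apply/funext.
have dC : differentiable (cst (y0 + (r `^ (1 - e)) *: beta) : U -> V) w.
  exact: differentiable_cst.
split; first exact: differentiableD.
move=> y; apply: (etrans (congr1 (@^~ y) (diffD dC dP))).
by rewrite -[RHS]add0r; congr (_ + _); rewrite diff_cst.
Qed.

End power_map.

(** * Real powers and scalar estimates for the u-component *)

Lemma powR_1B {R : realType} (e r : R) : 0 < r -> r `^ (1 - e) = r * r `^ (- e).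
Proof.
by move=> r0; rewrite powRD ?powRr1 ?(ltW r0)//; apply/implyP; rewrite (gt_eqF r0).
Qed.

Lemma le_powRN {R : realType} (e c r : R) : 0 <= e -> 0 < r <= c ->
  c `^ (- e) <= r `^ (- e).
Proof.
move=> e0 /andP[r0 rc]; have c0 := lt_le_trans r0 rc.
rewrite !powRN lef_pV2 ?posrE ?powR_gt0//.
by rewrite ge0_ler_powR ?nnegrE// ltW.
Qed.

(** Here [y] is r^(1-eps), [t] is c^(-eps), [alpha] is A(mu,eps) and [z] is the remainder. After
    multiplication by [sg], the value runs from about -ac/2 to at most about ac/2, since A0 y <= A0
    c t is nearly at most ac. The errors add up to at most 5sc, while the room left below c is
    (2-a)c/2 >= 10sc. *)
Lemma scalar_value_bound {R : realType} (A0 a s sg c t eta mu alpha y z : R) :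
  0 < A0 -> a < 2 -> 0 < s -> 20 * s <= a - 1 -> 20 * s <= 2 - a ->
  `|sg| = 1 -> 0 < c -> 0 <= eta -> 2 * eta <= s * A0 ->
  `|A0 * t - a| < s -> `|sg * mu + a / 2 * c| < s * c -> `|sg * alpha - A0| <= eta ->
  0 < y <= c * t -> `|z| <= eta * y ->
  `|mu + alpha * y + z| < c.
Proof.
move=> A0_gt0 a_lt2 s_gt0 s_le1 s_le2 sg1 c_gt0.
move=> eta_ge0 eta_le At muc alphaA.
have s1 : s <= 1 by lra.
move=> /andP[y0 yct] zy; rewrite -[ltLHS]mul1r -sg1 -normrM.
have {zy} : `|sg * z| <= eta * y by rewrite normrM sg1 mul1r.
move: At muc alphaA; rewrite !ltr_norml !ler_norml.
move=> /andP[At1 At2] /andP[mu1 mu2] /andP[al1 al2] /andP[z1 z2].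
have up : (sg * alpha) * y <= (A0 + eta) * y by rewrite ler_pM2r//; lra.
have lo : (A0 - eta) * y <= (sg * alpha) * y by rewrite ler_pM2r//; lra.
have etay : 2 * eta * y <= s * A0 * y by rewrite ler_pM2r.
have Ay : A0 * y <= c * (A0 * t) by rewrite mulrCA ler_pM2l.
have cAt : c * (A0 * t) < c * (a + s) by rewrite ltr_pM2l//; lra.
have Ay0 : 0 < A0 * y by exact: mulr_gt0.
have sAy : s * (A0 * y) <= s * (c * (a + s)) by rewrite ler_pM2l//; lra.
have sc0 : 0 < s * c by exact: mulr_gt0.
have ssc : s * (s * c) <= s * c by rewrite ler_piMl// ltW.
have asc : a * (s * c) <= 2 * (s * c) by rewrite ler_pM2r// ltW.
have sc1 : 20 * (s * c) <= (2 - a) * c by rewrite mulrA ler_pM2r.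
have s1Ay : s * (A0 * y) <= A0 * y by rewrite ler_piMl// ltW.
by apply/andP; split; lra.
Qed.

(** Here [X] is r^(-e) and [t] is c^(-e). The factor 1-e, the variation of A and the remainder
    together cost at most 2s A0 X, so the slope is at least (1-2s) A0 X. The first bound keeps the
    factor [X], to be cancelled against the u-derivative of the v-component; the second uses A0 X >
    a-s and gives the expansion. *)
Lemma scalar_slope_bound {R : realType} (A0 a s sg e t eta alpha X z : R) :
  0 < A0 -> a < 2 -> 0 < s -> 20 * s <= a - 1 -> 20 * s <= 2 - a ->
  `|sg| = 1 -> 0 < e <= s -> 0 <= eta -> 2 * eta <= s * A0 ->
  `|A0 * t - a| < s -> `|sg * alpha - A0| <= eta ->
  t <= X -> `|z| <= eta * X ->
  A0 / 2 * X <= `|(1 - e) * X * alpha + z| /\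
  (1 + a) / 2 <= `|(1 - e) * X * alpha + z|.
Proof.
move=> A0_gt0 a_lt2 s_gt0 s_le1 s_le2 sg1 /andP[e_gt0 e_le].
move=> eta_ge0 eta_le At alphaA.
move=> tX zX; have normE y : `|y| = `|sg * y| by rewrite normrM sg1 mul1r.
rewrite normE; move: zX; rewrite (normE z).
move: At alphaA; rewrite !ltr_norml !ler_norml.
move=> /andP[At1 At2] /andP[al1 al2] /andP[z1 z2].
have AtX : A0 * t <= A0 * X by rewrite ler_pM2l.
have AX0 : 0 < A0 * X by lra.
have X0 : 0 < X by rewrite -(pmulr_rgt0 _ A0_gt0).
have eX0 : 0 <= (1 - e) * X by rewrite mulr_ge0 ?ltW//; lra.
have lo : ((1 - e) * X) * (A0 - eta) <= ((1 - e) * X) * (sg * alpha).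
  by rewrite ler_wpM2l//; lra.
have etaX : 2 * eta * X <= s * A0 * X by rewrite ler_pM2r.
have eetaX : 0 <= e * (eta * X).
  exact: mulr_ge0 (ltW e_gt0) (mulr_ge0 eta_ge0 (ltW X0)).
have eAX : e * (A0 * X) <= s * (A0 * X) by rewrite ler_pM2r.
have key : (1 - 2 * s) * (A0 * X) <= sg * ((1 - e) * X * alpha + z) by lra.
have sAX : (1 - 2 * s) * (a - s) <= (1 - 2 * s) * (A0 * X).
  by rewrite ler_wpM2l//; lra.
have sAX20 : 20 * s * (A0 * X) <= 1 * (A0 * X) by rewrite ler_pM2r//; lra.
have sa : s * a <= s * 2 by rewrite ler_pM2l//; lra.
have ss : 0 <= s * s by exact: mulr_ge0 (ltW s_gt0) (ltW s_gt0).
have le_abs := ler_norm (sg * ((1 - e) * X * alpha + z)).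
by split; lra.
Qed.

(** Since mu is close to ac/2 up to sign and a < 2, every smallness requirement on mu follows from
    the same one on [c]. *)
Lemma scalar_offset_lt {R : realType} (a s sg c mu : R) :
  0 < c -> 1 < a -> a < 2 -> 20 * s <= 2 - a -> `|sg| = 1 ->
  `|sg * mu + a / 2 * c| < s * c -> `|mu| < c.
Proof.
move=> c0 a1 a2 s_le sg1 muc; rewrite -[ltLHS]mul1r -sg1 -normrM.
have sc : 20 * (s * c) <= (2 - a) * c by rewrite mulrA ler_pM2r.
have ac0 : 0 < a * c by rewrite mulr_gt0//; lra.
have ac2 : a * c < 2 * c by rewrite ltr_pM2r.
by move: muc; rewrite !ltr_norml => /andP[? ?]; apply/andP; split; lra.
Qed.

(** * The attractor at one parameter value, under explicit smallness conditions *)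

(** The quantity [tau], of order c, bounds r^(1-eps) on 0 < r <= c, hence also the v-derivatives.
    The last four conditions on it give, in order, trapping in v and in its image under [Q],
    contraction in v, and the cone inequality. *)
Lemma lorenz_attractor_at {R : realType} {k : nat} (Q : 'M[R]_k)
    (A : R -> R -> R) (B vp : R -> R -> 'rV[R]_k)
    (p : R -> 'rV[R]_k -> R -> R -> R) (q : R -> 'rV[R]_k -> R -> R -> 'rV[R]_k)
    (delta K c K' L M A0 a s sg eta mu eps : R) :
  Q *m Q = 1%:M -> (forall v : 'rV[R]_k, `|v *m Q| <= L * `|v|) -> 1 <= L ->
  0 < A0 -> 1 < a < 2 -> 0 < s -> 20 * s <= a - 1 -> 20 * s <= 2 - a ->
  `|sg| = 1 -> 0 < c < delta -> 0 < K' < K -> 0 < eps <= s ->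
  0 <= eta <= 1 -> 2 * eta <= s * A0 ->
  `|A0 * c `^ (- eps) - a| < s -> `|sg * mu + a / 2 * c| < s * c ->
  `|sg * A mu eps - A0| <= eta -> `|B mu eps| <= M ->
  (forall r w, 0 < r <= c -> `|w| <= K' ->
     [/\ derivable (fun r' => p r' w mu eps) r 1,
         derivable (fun r' => q r' w mu eps) r 1,
         differentiable (fun w' => p r w' mu eps) w &
         differentiable (fun w' => q r w' mu eps) w]) ->
  (forall r w, 0 < r <= c -> `|w| <= K' ->
     `|p r w mu eps| <= eta * r `^ (1 - eps) /\
     `|q r w mu eps| <= eta * r `^ (1 - eps) /\
     [/\ (forall h, `|'d (fun w' => p r w' mu eps) w h|
                      <= eta * r `^ (1 - eps) * `|h|),
         (forall h, `|'d (fun w' => q r w' mu eps) w h|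
                      <= eta * r `^ (1 - eps) * `|h|),
         `|derive1 (fun r' => p r' w mu eps) r| <= eta * r `^ (- eps) &
         `|derive1 (fun r' => q r' w mu eps) r| <= eta * r `^ (- eps)]) ->
  let tau := 3 / A0 * c in
  `|vp mu eps| + L * ((M + 1) * tau) < K' ->
  `|vp mu eps *m Q| + L * ((M + 1) * tau) < K' ->
  L * tau * L <= 1 / 2 ->
  L * ((M + 1) * (2 / A0)) * (tau * L) < (1 - ((1 + a) / 2)^-1) * (1 / 2) ->
  lorenz_attractor (poincare_u Q A p mu eps) (poincare_v Q B vp q mu eps)
    (section_box Q delta K) (mu, vp mu eps) (- mu, vp mu eps *m Q).
Proof.
move=> QQ QL L1 A0_gt0 /andP[a1 a2] s_gt0 s_le1 s_le2 sg1 /andP[c0 cdelta].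
move=> /andP[K'0 K'K] eps_s /andP[eta0 eta1] eta_le At muc alA BM reg est tau.
move=> vpK vpQK Ltau Lcone.
have L0 : 0 < L by exact: lt_le_trans ltr01 L1.
have M0 : 0 <= M by exact: le_trans (normr_ge0 _) BM.
have /andP[eps0 epss] := eps_s.
have tau0 : 0 < tau by rewrite mulr_gt0// divr_gt0.
have M1 : 0 <= M + 1 by exact: addr_ge0.
have Mtau0 : 0 <= L * ((M + 1) * tau).
  exact: mulr_ge0 (ltW L0) (mulr_ge0 M1 (ltW tau0)).
have t0 : 0 < c `^ (- eps) by rewrite powR_gt0.
(* The 3 in [tau] comes from A0 c^(-eps) < a + s < 3. *)
have t3 : c * c `^ (- eps) <= tau.
  rewrite mulrC ler_pM2r// ler_pdivlMr// mulrC.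
  by move: At; rewrite ltr_norml => /andP[_ ?]; lra.
have pow r : 0 < r <= c ->
    [/\ c `^ (- eps) <= r `^ (- eps), 0 < r `^ (1 - eps) <= c * c `^ (- eps)
     & r `^ (1 - eps) <= tau].
  move=> rc; have /andP[r0 r_c] := rc.
  have le_t : r `^ (1 - eps) <= c * c `^ (- eps).
    by rewrite -powR_1B// ge0_ler_powR ?nnegrE ?(ltW r0) ?(ltW c0)//; lra.
  by rewrite le_powRN ?(ltW eps0)// powR_gt0// le_t (le_trans le_t).
have etapow r : 0 < r <= c -> eta * r `^ (1 - eps) <= tau.
  by case/pow=> _ _ rtau; rewrite -[leRHS]mul1r ler_pM// powR_ge0.
have muc1 := scalar_offset_lt a s sg c mu c0 a1 a2 s_le2 sg1 muc.
pose F r w := mu + (r `^ (1 - eps)) *: (A mu eps : R^o) + p r w mu eps.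
pose G r w := vp mu eps + (r `^ (1 - eps)) *: B mu eps + q r w mu eps.
have vpK0 : `|vp mu eps| < K by lra.
have vpQK0 : `|vp mu eps *m Q| < K by lra.
have Fpos u v : 0 < u -> poincare_u Q A p mu eps (u, v) = F u v.
  by move=> u0; rewrite /poincare_u /Qs /= u0 gtr0_norm// gtr0_sg// mulr1 mulrC.
have Fneg u v : u < 0 -> poincare_u Q A p mu eps (u, v) = - F (- u) (v *m Q).
  move=> u0; rewrite /poincare_u /Qs /= (le_gtF (ltW u0)) ltr0_norm// ltr0_sg//.
  by rewrite mulrN1 [A _ _ * _]mulrC.
have Gpos u v : 0 < u -> poincare_v Q B vp q mu eps (u, v) = G u v.
  by move=> u0; rewrite /poincare_v /Qs /= u0 gtr0_norm.
have Gneg u v : u < 0 -> poincare_v Q B vp q mu eps (u, v) = G (- u) (v *m Q) *m Q.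
  by move=> u0; rewrite /poincare_v /Qs /= (le_gtF (ltW u0)) ltr0_norm.
have Fslope r w : 0 < r <= c -> `|w| <= K' ->
    A0 / 2 * r `^ (- eps) <= `|derive1 (F^~ w) r| /\
    (1 + a) / 2 <= `|derive1 (F^~ w) r|.
  move=> rc wK; have [dp _ _ _] := reg r w rc wK.
  have [_ [_ [_ _ dp_le _]]] := est r w rc wK.
  have [tX _ _] := pow r rc; have /andP[r0 _] := rc.
  have [_ ->] := power_map_derive1 mu (A mu eps : R^o)
    (fun r w => p r w mu eps) eps r w r0 dp.
  exact: (scalar_slope_bound A0 a s sg eps (c `^ (- eps)) eta).
apply: (equivariant_lorenz_attractor Q _ _ F G _ _ delta K c K' L
  ((1 + a) / 2) ((M + 1) * (2 / A0)) tau tau QQ QL L1 _ _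
  Fpos Fneg Gpos Gneg).
- by rewrite c0.
- by rewrite K'0.
- move=> r w rc wK; have [dp dq dpw dqw] := reg r w rc wK.
  have /andP[r0 _] := rc; split.
  + by have [] := power_map_derive1 mu (A mu eps : R^o)
      (fun r w => p r w mu eps) eps r w r0 dp.
  + by have [] := power_map_derive1 (vp mu eps) (B mu eps)
      (fun r w => q r w mu eps) eps r w r0 dq.
  + by have [] := power_map_diff mu (A mu eps : R^o)
      (fun r w => p r w mu eps) eps r w dpw.
  + by have [] := power_map_diff (vp mu eps) (B mu eps)
      (fun r w => q r w mu eps) eps r w dqw.
- move=> r w rc wK; have [dp dq dpw dqw] := reg r w rc wK.
  have [_ [_ [dpw_le dqw_le dp_le dq_le]]] := est r w rc wK.
  have [slopeX slope_a] := Fslope r w rc wK.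
  have /andP[r0 _] := rc; have X0 := powR_ge0 r (- eps); split.
  + exact: slope_a.
  + have [_ ->] := power_map_derive1 (vp mu eps) (B mu eps)
      (fun r w => q r w mu eps) eps r w r0 dq.
    have GX : `|((1 - eps) * r `^ (- eps)) *: B mu eps
              + derive1 (fun r' => q r' w mu eps) r| <= (M + 1) * r `^ (- eps).
      rewrite [leRHS]mulrDl; apply: (le_trans (ler_normD _ _)); apply: lerD; last first.
        by apply: (le_trans dq_le); rewrite ler_wpM2r.
      rewrite normrZ mulrC ler_pM// normrM (ger0_norm X0) -[leRHS]mul1r ler_wpM2r//.
      by rewrite ler_norml; apply/andP; split; lra.
    (* Both u-derivatives are of order r^(-eps), which cancels: the ratio is at most M+1 over
       A0/2. *)
    apply: (le_trans GX); rewrite -mulrA ler_wpM2l//.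
    by rewrite -ler_pdivrMl ?divr_gt0// invf_div.
  + move=> y; have [_ ->] := power_map_diff mu (A mu eps : R^o)
      (fun r w => p r w mu eps) eps r w dpw.
    by apply: (le_trans (dpw_le y)); rewrite ler_wpM2r// etapow.
  + move=> y; have [_ ->] := power_map_diff (vp mu eps) (B mu eps)
      (fun r w => q r w mu eps) eps r w dqw.
    by apply: (le_trans (dqw_le y)); rewrite ler_wpM2r// etapow.
- move=> r w rc wK; have [p_le [q_le _]] := est r w rc wK.
  have [_ rt rtau] := pow r rc; have y0 := powR_ge0 r (1 - eps).
  have Gvp : `|r `^ (1 - eps) *: B mu eps + q r w mu eps| <= (M + 1) * tau.
    rewrite [leRHS]mulrDl; apply: (le_trans (ler_normD _ _)); apply: lerD.
      by rewrite normrZ (ger0_norm y0) mulrC ler_pM.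
    by rewrite mul1r (le_trans q_le)// etapow.
  split.
  + rewrite /F [_ *: _]mulrC.
    exact: (scalar_value_bound A0 a s sg c (c `^ (- eps)) eta).
  + rewrite /G -addrA; apply: le_lt_trans vpK; apply: (le_trans (ler_normD _ _)).
    rewrite lerD2l (le_trans Gvp)// ler_peMl//; exact: mulr_ge0 M1 (ltW tau0).
  + rewrite /G -addrA mulmxDl; apply: le_lt_trans vpQK.
    apply: (le_trans (ler_normD _ _)); rewrite lerD2l (le_trans (QL _))//.
    by rewrite ler_pM2l.
- by lra.
- exact: ltW.
- exact: ltW.
- by rewrite mulr_ge0// divr_ge0// ltW.
- by lra.
- apply: (lt_le_trans Lcone); rewrite ler_wpM2l//; last by lra.
  by rewrite subr_ge0 invf_le1//; lra.
- split; first exact: lt_trans cdelta.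
  by split.
- split; first by rewrite /= normrN; exact: lt_trans cdelta.
  by split=> //=; rewrite -mulmxA QQ mulmx1.
Qed.

(** * The parameter region: openness and adherence to the origin *)

(* [c] is the half-width of the trapping region in the u-direction and [sg] the
   sign of [A 0 0]; [c] is existentially quantified, rather than solved for as a
   function of [eps], to make openness immediate. *)
Definition lorenz_region {R : realType} (A0 a s sg c0 e0 : R) : set (R * R) :=
  [set z | exists2 c, 0 < c < c0 &
     [/\ 0 < z.2 < e0, `|A0 * c `^ (- z.2) - a| < s &
         `|sg * z.1 + a / 2 * c| < s * c]].

Lemma open_lorenz_region {R : realType} (A0 a s sg c0 e0 : R) :
  open (lorenz_region A0 a s sg c0 e0).
Proof.
pose slope (c : R) (z : R * R) : R := `|A0 * c `^ (- z.2) - a|.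
pose offset (c : R) (z : R * R) : R := `|sg * z.1 + a / 2 * c|.
pose eps (z : R * R) : R := z.2.
have -> : lorenz_region A0 a s sg c0 e0 = \bigcup_(c in [set c : R | 0 < c < c0])
    (eps @^-1` [set y | 0 < y] `&` eps @^-1` [set y | y < e0] `&`
     slope c @^-1` [set y | y < s] `&` offset c @^-1` [set y | y < s * c]).
  apply/seteqP; split=> z /=.
    by move=> [c cc0 [/andP[? ?] ? ?]]; exists c.
  by move=> [c cc0 [[[/= ? ?] ?] ?]]; exists c => //; split=> //; apply/andP.
apply: bigcup_open => c /andP[cp _].
have epsc : continuous eps by move=> z; exact: cvg_snd.
have powc : continuous (fun z : R * R => c `^ (- z.2)).
  have -> : (fun z : R * R => c `^ (- z.2)) = expR \o (fun z : R * R => - z.2 * ln c).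
    by apply/funext => w /=; rewrite /powR gt_eqF.
  move=> z; apply: continuous_comp; last exact: continuous_expR.
  by apply: cvgM; [apply: cvgN; exact: cvg_snd|exact: cvg_cst].
have slopec : continuous (slope c).
  move=> z; apply: cvg_norm; apply: cvgB; last exact: cvg_cst.
  by apply: cvgM; [exact: cvg_cst|exact: powc].
have offsetc : continuous (offset c).
  move=> z; apply: cvg_norm; apply: cvgD; last exact: cvg_cst.
  by apply: cvgM; [exact: cvg_cst|exact: cvg_fst].
apply: openI; [apply: openI; [apply: openI|]|].
- by apply: open_comp => //; exact: open_gt.
- by apply: open_comp => //; exact: open_lt.
- by apply: open_comp => //; exact: open_lt.
- by apply: open_comp => //; exact: open_lt.
Qed.

(** For small eps > 0 take c = exp(-l/eps) with l = ln(a/A0), so that A0 c^(-eps) = a exactly, and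
    mu = -sg ac/2, so that the offset vanishes. As A0 < a gives l > 0, [c] and hence mu tend to 0
    with eps. *)
Lemma closure_lorenz_region {R : realType} (A0 a s sg c0 e0 : R) :
  0 < A0 < a -> a < 2 -> 0 < s -> sg * sg = 1 -> 0 < c0 -> 0 < e0 ->
  closure (lorenz_region A0 a s sg c0 e0) (0, 0).
Proof.
move=> /andP[A0_gt0 A0a] a2 s0 sg1 c0_gt0 e0_gt0 U /nbhs_ballP[rho /= rho0 rhoU].
have a0 : 0 < a by exact: lt_trans A0a.
pose l := ln (a / A0).
have l0 : 0 < l by rewrite ln_gt0// ltr_pdivlMr// mul1r.
pose c1 := Num.min c0 rho.
have c1_gt0 : 0 < c1 by rewrite lt_min c0_gt0.
(* Taking eps < l/N yields l/eps > N > -ln c1, that is c < c1. *)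
pose N := 1 + `|ln c1|.
have N0 : 0 < N by rewrite ltr_pwDl.
pose m := Num.min (Num.min e0 rho) (l / N).
have m0 : 0 < m by rewrite !lt_min e0_gt0 rho0 divr_gt0.
pose eps := m / 2.
have eps0 : 0 < eps by rewrite divr_gt0.
have epsm : eps < m by rewrite /eps ltr_pdivrMr// ltr_pMr// ltr1n.
move: (epsm); rewrite !lt_min => /andP[/andP[eps_e eps_rho] eps_l].
pose c := expR (- (l / eps)).
have c_gt0 : 0 < c by exact: expR_gt0.
have cc1 : c < c1.
  rewrite -(lnK c1_gt0) ltr_expR ltrNl.
  have Nl : N < l / eps by rewrite ltr_pdivlMr// mulrC -ltr_pdivlMr.
  have := ler_norm (- ln c1); rewrite normrN => lnc1.
  apply: le_lt_trans Nl; apply: (le_trans lnc1); by rewrite lerDr.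
move: (cc1); rewrite lt_min => /andP[cc0 crho].
have slope : c `^ (- eps) = a / A0.
  rewrite /powR gt_eqF// /c expRK mulNr mulrN opprK mulrCA divff ?gt_eqF// mulr1.
  by rewrite lnK// posrE divr_gt0.
exists (- sg * (a / 2 * c), eps); split; last first.
  apply: rhoU; split; rewrite /= /ball/= sub0r normrN; last by rewrite gtr0_norm.
  have sgn : `|sg| = 1.
    by apply/eqP; rewrite -(@eqrXn2 _ 2)// -normrX expr2 sg1 normr1 expr1n.
  rewrite normrM normrN sgn mul1r gtr0_norm; last by rewrite mulr_gt0 ?divr_gt0.
  apply: lt_trans crho; rewrite gtr_pMl// ltr_pdivrMr// mul1r; exact: a2.
exists c; first by rewrite c_gt0.
split; first by rewrite eps0.
- by rewrite slope mulrCA divff ?gt_eqF// mulr1 subrr normr0.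
- by rewrite /= mulrA mulrN sg1 mulN1r addNr normr0 mulr_gt0.
Qed.

(** * Choice of the constants and conclusion *)

Lemma continuous2_near0 {R : realType} {V : normedModType R} (h : R -> R -> V) (e : R) :
  continuous (fun z : R * R => h z.1 z.2) -> 0 < e ->
  exists2 d, 0 < d & forall x y, `|x| < d -> `|y| < d -> `|h x y - h 0 0| <= e.
Proof.
move=> hc e0; have := hc (0, 0); move/cvgrPdist_le => /(_ e e0).
move=> /nbhs_ballP[d /= d0 dP]; exists d => // x y xd yd.
rewrite distrC; apply: (dP (x, y)).
by split; rewrite /= /ball /= sub0r normrN.
Qed.

Lemma small_multiple {R : realType} (C e : R) : 0 <= C -> 0 < e ->
  exists2 d, 0 < d & forall c, 0 < c < d -> C * c < e.
Proof.
move=> C0 e0; have C1 : 0 < C + 1 by rewrite ltr_wpDl.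
exists (e / (C + 1)); first exact: divr_gt0.
move=> c /andP[c0]; rewrite ltr_pdivlMr// mulrDr mulr1 mulrC => cC.
by apply: lt_trans cC; rewrite ltrDl.
Qed.

Theorem theorem2 (R : realType) (n : nat) (hn : (2 <= n)%N)
  (Q : 'M[R]_(n.-1)) (hQ : Q *m Q = 1%:M)
  (A : R -> R -> R) (B vp : R -> R -> 'rV[R]_(n.-1))
  (p : R -> 'rV[R]_(n.-1) -> R -> R -> R)
  (q : R -> 'rV[R]_(n.-1) -> R -> R -> 'rV[R]_(n.-1))
  (delta0 K : R) (hdelta0 : 0 < delta0) (hK : 0 < K)
  (hvp0 : `|vp 0 0| < K /\ `|vp 0 0 *m Q| < K)
  (hAc : continuous (fun z : R * R => A z.1 z.2))
  (hBc : continuous (fun z : R * R => B z.1 z.2))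
  (hvpc : continuous (fun z : R * R => vp z.1 z.2))
  (hA0 : 0 < `|A 0 0| < 2)
  (hreg : forall mu eps r w, `|mu| < delta0 -> `|eps| < delta0 ->
     0 < r < delta0 -> `|w| < K ->
     [/\ derivable (fun r' => p r' w mu eps) r 1,
         derivable (fun r' => q r' w mu eps) r 1,
         differentiable (fun w' => p r w' mu eps) w &
         differentiable (fun w' => q r w' mu eps) w])
  (hest : forall eta : R, 0 < eta -> exists delta : R, 0 < delta /\
     forall mu eps r w, `|mu| < delta -> `|eps| < delta ->
     0 < r < delta -> `|w| < K ->
     `|p r w mu eps| <= eta * r `^ (1 - eps) /\
     `|q r w mu eps| <= eta * r `^ (1 - eps) /\
     [/\ (forall h, `|'d (fun w' => p r w' mu eps) w h|
                      <= eta * r `^ (1 - eps) * `|h|),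
         (forall h, `|'d (fun w' => q r w' mu eps) w h|
                      <= eta * r `^ (1 - eps) * `|h|),
         `|derive1 (fun r' => p r' w mu eps) r| <= eta * r `^ (- eps) &
         `|derive1 (fun r' => q r' w mu eps) r| <= eta * r `^ (- eps)]) :
  exists VLA : set (R * R),
    open VLA /\ closure VLA (0, 0) /\
    forall mu eps, VLA (mu, eps) ->
      lorenz_attractor (poincare_u Q A p mu eps) (poincare_v Q B vp q mu eps)
        (section_box Q delta0 K) (mu, vp mu eps) (- mu, vp mu eps *m Q).
Proof.
have /andP[A0_gt0 A0_lt2] := hA0; set A0 := `|A 0 0| in A0_gt0 A0_lt2.
pose sg := Num.sg (A 0 0).
have A00 : A 0 0 != 0 by rewrite -normr_gt0.
have sgsg : sg * sg = 1 by rewrite -expr2 sqr_sg A00.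
have sg1 : `|sg| = 1 by rewrite normr_sg A00.
have sgA : sg * A 0 0 = A0 by rewrite /A0 normrEsg.
have [L L1 QL] := mulmx_norm_bound Q.
have L0 : 0 < L by exact: lt_le_trans L1.
(* The target slope: [1 < a] for expansion, [a < 2] for trapping, and [A0 < a] so that c^(-eps) =
   a/A0 > 1 is reached with small c and eps > 0. The hypothesis [A0 < 2] leaves room for it. *)
have [a [a1 a2 A0a]] : exists a, [/\ 1 < a, a < 2 & A0 < a].
  have [A01|A01] := leP A0 1; first by exists (3 / 2); split; lra.
  by exists ((A0 + 2) / 2); split; lra.
have [s [s0 sa1 sa2]] : exists s, [/\ 0 < s, 20 * s <= a - 1 & 20 * s <= 2 - a].
  have [h|h] := leP (a - 1) (2 - a).
    by exists ((a - 1) / 20); split; lra.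
  by exists ((2 - a) / 20); split; lra.
(* The variation of A and the remainder then each cost at most the fraction s/2 of the leading
   term. *)
pose eta := s * A0 / 2.
have eta0 : 0 < eta by rewrite divr_gt0// mulr_gt0.
have eta1 : eta <= 1.
  have : s * A0 <= s * 2 by rewrite ler_pM2l// ltW.
  by rewrite /eta; lra.
have eta2 : 2 * eta <= s * A0 by rewrite /eta mulrCA divff// mulr1.
have [m [mK m1 m2]] : exists m, [/\ m < K, `|vp 0 0| <= m & `|vp 0 0 *m Q| <= m].
  exists (Num.max `|vp 0 0| `|vp 0 0 *m Q|).
  by rewrite gt_max hvp0.1 hvp0.2 !le_max !lexx orbT.
(* [K'] is the midpoint of [m] and [K]. One [gap] above [m] absorbs the variation of [vp], also
   after applying [Q], whence [gap / L] below; the other absorbs the terms with [B] and [q]. *)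
pose gap := (K - m) / 4.
have gap0 : 0 < gap by rewrite divr_gt0// subr_gt0.
pose K' := m + 2 * gap.
have m0 : 0 <= m by exact: le_trans m1.
have K'0 : 0 < K' by rewrite /K'; lra.
have K'K : K' < K by rewrite /K' /gap; lra.
pose M := `|B 0 0| + 1.
have M1 : 0 <= M + 1 by rewrite /M !addr_ge0.
have gapL : 0 < gap / L by exact: divr_gt0.
have [dA dA0 dAP] := continuous2_near0 A eta hAc eta0.
have [dB dB0 dBP] := continuous2_near0 B 1 hBc ltr01.
have [dv dv0 dvP] := continuous2_near0 vp (gap / L) hvpc gapL.
have [dest [dest0 destP]] := hest eta eta0.
have A3 : 0 <= 3 / A0 by rewrite divr_ge0// ltW.
have A2 : 0 <= 2 / A0 by rewrite divr_ge0// ltW.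
have L0' := ltW L0.
pose slack := (1 - ((1 + a) / 2)^-1) * (1 / 2).
have slack0 : 0 < slack.
  by rewrite /slack mulr_gt0 ?subr_gt0 ?invf_lt1//; lra.
(* The v-trapping, contraction and cone conditions are linear in [c] through [tau]; [C1], [C2], [C3]
   concern their coefficients, and [slack] is the right side of the cone condition. *)
have C1 : 0 <= L * ((M + 1) * (3 / A0)) by exact: mulr_ge0 L0' (mulr_ge0 M1 A3).
have C2 : 0 <= L * (3 / A0) * L by exact: mulr_ge0 (mulr_ge0 L0' A3) L0'.
have C3 : 0 <= L * ((M + 1) * (2 / A0)) * (3 / A0 * L).
  exact: mulr_ge0 (mulr_ge0 L0' (mulr_ge0 M1 A2)) (mulr_ge0 A3 L0').
have half0 : (0 : R) < 1 / 2 by rewrite divr_gt0.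
have [d1 d10 d1P] := small_multiple _ _ C1 gap0.
have [d2 d20 d2P] := small_multiple _ _ C2 half0.
have [d3 d30 d3P] := small_multiple _ _ C3 slack0.
(* The bound [c < D] also controls r <= c and |mu| < c, so [D] limits all the small quantities once
   eps is below it too. *)
pose D := Num.min delta0 (Num.min dA (Num.min dB (Num.min dv dest))).
have D0 : 0 < D by rewrite !lt_min hdelta0 dA0 dB0 dv0.
pose c0 := Num.min D (Num.min d1 (Num.min d2 d3)).
have c0_gt0 : 0 < c0 by rewrite lt_min D0 !lt_min d10 d20.
pose e0 := Num.min s D.
have e0_gt0 : 0 < e0 by rewrite lt_min s0.
exists (lorenz_region A0 a s sg c0 e0); split; first exact: open_lorenz_region.
split; first by apply: closure_lorenz_region; rewrite ?A0_gt0.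
move=> mu eps [c /andP[c_gt0 cc0] [/= /andP[eps_gt0 epse0] slope offset]].
move: cc0; rewrite !lt_min => /andP[/and5P[cdelta0 cA cB cv cest] /and3P[c1 c2 c3]].
move: epse0; rewrite !lt_min => /andP[eps_s /and5P[eps_delta0 epsA epsB epsv epsest]].
have muc := scalar_offset_lt a s sg c mu c_gt0 a1 a2 sa2 sg1 offset.
have absE : `|eps| = eps by rewrite gtr0_norm.
have mu_lt e : c < e -> `|mu| < e by exact: lt_trans.
have eps_lt e : eps < e -> `|eps| < e by rewrite absE.
have vpd : `|vp mu eps - vp 0 0| <= gap / L by apply: dvP; [exact: mu_lt|exact: eps_lt].
have vp_le : `|vp mu eps| <= m + gap.
  rewrite -[vp mu eps](subrK (vp 0 0)) addrC; apply: (le_trans (ler_normD _ _)).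
  apply: lerD => //; apply: (le_trans vpd).
  by rewrite ler_pdivrMr// ler_peMr// ltW.
have vpQ_le : `|vp mu eps *m Q| <= m + gap.
  rewrite -[vp mu eps](subrK (vp 0 0)) addrC mulmxDl.
  apply: (le_trans (ler_normD _ _)); apply: lerD => //.
  by apply: (le_trans (QL _)); rewrite mulrC -ler_pdivlMr.
have tauE : L * ((M + 1) * (3 / A0 * c)) < gap.
  by have := d1P c; rewrite c_gt0 c1 -!mulrA => /(_ isT).
apply: (lorenz_attractor_at Q A B vp p q delta0 K c K' L M A0 a s sg eta mu eps) => //.
- by rewrite a1.
- by rewrite c_gt0.
- by rewrite K'0.
- by rewrite eps_gt0 ltW.
- by rewrite ltW.
- rewrite -sgA -mulrBr normrM sg1 mul1r.
  by apply: dAP; [exact: mu_lt|exact: eps_lt].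
- rewrite -[B mu eps](subrK (B 0 0)) addrC /M; apply: (le_trans (ler_normD _ _)).
  by rewrite lerD2l; apply: dBP; [exact: mu_lt|exact: eps_lt].
- move=> r w /andP[r0 rc] wK; apply: hreg; [exact: mu_lt|exact: eps_lt| |].
    by rewrite r0 (le_lt_trans rc).
  exact: le_lt_trans K'K.
- move=> r w /andP[r0 rc] wK; apply: destP; [exact: mu_lt|exact: eps_lt| |].
    by rewrite r0 (le_lt_trans rc).
  exact: le_lt_trans K'K.
- by rewrite /K'; lra.
- by rewrite /K'; lra.
- by have := d2P c; rewrite c_gt0 c2 => /(_ isT) /ltW; rewrite !mulrA [_ * L * c]mulrAC.
- have := d3P c; rewrite c_gt0 c3 => /(_ isT).
  by rewrite -/slack -!mulrA [L * c]mulrC.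
Qed.
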